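(* Let $A=(a_{ij})$ be a $4\times 4$ symmetric homogeneous matrix of non-negative integers, and let $d=\mathrm{tr}(A)/2$. Then a general form of degree $d$ in $\mathbb{C}[x_1,\dots,x_4]$ is the sum of two pfaffians of skew-symmetric $4\times 4$ matrices of forms in $\mathbb{C}[x_1,\dots,x_4]$ whose degree matrix is $A$.
   Context: An integer matrix $A=(a_{ij})$ is called homogeneous if $a_{ij}+a_{lm}=a_{im}+a_{lj}$ for every choice of the indices $i,j,l,m$. A matrix $M=(F_{ij})$ of homogeneous forms has degree matrix $A=(a_{ij})$ if each $F_{ij}$ is homogeneous of degree $a_{ij}$; the zero polynomial is allowed as a form of any degree. If $A$ is symmetric and homogeneous of even size then its trace is even, and the pfaffian of a skew-symmetric matrix with degree matrix $A$ is a homogeneous form of degree $\mathrm{tr}(A)/2$ (or zero). ''A general form of degree $d$'' has a property if the property holds for all forms in some non-empty Zariski open subset of the vector space of forms of degree $d$. *)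

(* Defs.v *)
From HB Require Import structures.
From mathcomp Require Import all_boot all_order all_algebra.
From mathcomp Require Import complex reals mpoly ring.

Set Implicit Arguments.
Unset Strict Implicit.
Unset Printing Implicit Defensive.

Import GRing.Theory.
Local Open Scope ring_scope.

Definition homogeneous_mx (V : nmodType) (m n : nat) (A : 'M[V]_(m, n)) : Prop :=
  forall (i l : 'I_m) (j k : 'I_n), A i j + A l k = A i k + A l j.

(* The zero polynomial is d.-homog for every d. *)
Definition has_degree_mx (K : nzRingType) (n m : nat)
    (M : 'M[{mpoly K[n]}]_m) (A : 'M[nat]_m) : Prop :=
  forall i j : 'I_m, M i j \is (A i j).-homog.

Definition skew_symmetric (S : zmodType) (m : nat) (M : 'M[S]_m) : Prop :=
  M^T = - M.

(* The indices are written in the ring 'I_4. *)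
Definition pfaffian4 (S : pzRingType) (M : 'M[S]_4) : S :=
  M 0 1 * M 2 3 - M 0 2 * M 1 3 + M 0 3 * M 1 2.

(* The diagonal hypothesis follows from skew-symmetry unless 2 is a zero
   divisor. *)
Lemma pfaffian4_sqr (S : comPzRingType) (M : 'M[S]_4) :
  skew_symmetric M -> (forall i, M i i = 0) -> pfaffian4 M ^+ 2 = \det M.
Proof.
move=> skM dM.
have sk i j : M i j = - M j i.
  by have /matrixP /(_ j i) := skM; rewrite !mxE.
pose a (i j : nat) := M (inord i) (inord j).
have aE (i j : 'I_4) : M i j = a i j by rewrite /a !inord_val.
rewrite /pfaffian4.
do 3 rewrite !(expand_det_row _ ord0, big_ord_recl, big_ord0) /cofactor.
rewrite !det_mx11 !mxE !aE /= /bump /= ?addn0 ?add0n.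
have ska i j : a i j = - a j i by exact: sk.
have da i : a i i = 0 by exact: dM.
rewrite !da (ska 1%N 0%N) (ska 2%N 0%N) (ska 3%N 0%N).
rewrite (ska 2%N 1%N) (ska 3%N 1%N) (ska 3%N 2%N).
ring.
Qed.

(* The Zariski topology does not depend on the basis that supplies the
   coordinates, since a linear change of coordinates preserves polynomials. *)
Definition zariski_closed (K : fieldType) (V : vectType K) (Z : V -> Prop) : Prop :=
  exists S : {mpoly K[\dim {:V}]} -> Prop,
    forall v : V,
      Z v <-> (forall P, S P -> P.@[fun i => coord (vbasis {:V}) i v] = 0).

Definition zariski_open (K : fieldType) (V : vectType K) (U : V -> Prop) : Prop :=
  zariski_closed (fun v => ~ U v).

Definition for_general (K : fieldType) (V : vectType K) (P : V -> Prop) : Prop :=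
  exists U : V -> Prop,
    [/\ zariski_open U, exists v, U v & forall v, U v -> P v].

(* Main.v *)
Require Import Defs.
From HB Require Import structures.
From mathcomp Require Import all_boot all_order all_algebra.
From mathcomp Require Import complex reals mpoly ring closed_field.

(** Let a form F of degree d be a sum of four products P_k Q_k, where the degrees
    of P_k and Q_k are prescribed and have sum d. If these degrees are a01, a23
    and a03, a12, each taken twice, the four products make up two pfaffians, of
    skew-symmetric matrices whose entries at (0,2) and (1,3) are zero. So it is
    enough to show that a general form is such a sum.

    The sum of the products is a quadratic map from the space of the P_k and Q_k
    to the space of forms of degree d. Over an algebraically closed field its
    image is definable without quantifiers, hence either contains a non-empty
    open set or lies in a hypersurface h = 0
    ([image_dense_or_in_hypersurface]). If the differential is surjective at one
    point, the curves in the image through the image c of that point have all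
    directions as tangents, and then the lowest form of h at c vanishes
    identically; so h = 0 ([eq0_on_tangent_curves], [for_general_quadratic]).

    It remains to find a point with surjective differential, that is, eight
    forms with the given degrees whose ideal contains all forms of degree d. The
    forms are powers of eight linear forms, in two families of four; each family
    spans a three-dimensional space of linear forms and consists of two pairs,
    each pair spanning a plane in that space ([eight_form]). The two exponents of
    a pair have sum d.

    Let D be the derivation that kills one family. The derivative of the degree d
    part of the ideal contains the degree d - 1 part of the ideal in which the
    exponents of the other family are lowered by 1, by integration by parts
    ([dderiv_antiderivative]). If that part is everything, the degree d part of
    the ideal contains every form up to a form killed by D ([filled_step]), that
    is, a form in three variables. The same argument treats these, with the two
    pairs as families; then the binary forms, with the two elements of a pair;
    then the powers of one linear form. Inside each of the first two levels the
    two families take turns ([filled_join]): a turn lowers the degree by 1 and the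
    sums of the other family by 2, so the required bounds on the sums persist
    until an exponent reaches 0 and the ideal is trivial. Geometrically, this is
    the dual of dividing a form that vanishes to high order at eight points of two
    planes by the equations of the planes, in turn. *)

Set Implicit Arguments.
Unset Strict Implicit.
Unset Printing Implicit Defensive.

Import GRing.Theory.
Local Open Scope ring_scope.

(** * Polynomials that vanish everywhere *)

Local Notation widen := (widen_ord (leqnSn _)).

Lemma poly_neq0_horner (K : numFieldType) (p : {poly K}) :
  p != 0 -> exists t, p.[t] != 0.
Proof.
move=> pN0; pose rs : seq K := [seq i%:R | i <- iota 0 (size p)].
have urs : uniq rs.
  rewrite map_inj_uniq ?iota_uniq // => i j /eqP.
  by rewrite Num.Theory.eqr_nat => /eqP.
have : ~~ all (root p) rs.
  apply/negP => rrs; have := max_poly_roots pN0 rrs urs.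
  by rewrite size_map size_iota ltnn.
by case/allPn=> t _ pt; exists t.
Qed.

Lemma poly_eq0_horner (K : numFieldType) (p : {poly K}) :
  (forall t, p.[t] = 0) -> p = 0.
Proof.
move=> p0; apply/eqP/negPn/negP => /poly_neq0_horner[t].
by rewrite p0 eqxx.
Qed.

Lemma muni_eq0 (n : nat) (K : nzRingType) (p : {mpoly K[n.+1]}) :
  muni p = 0 -> p = 0.
Proof.
move=> p0; apply/mpolyP => m.
pose m' := [multinom m (widen i) | i < n].
have <- : ((muni p)`_(m ord_max))@_m' = 0@_m by rewrite p0 coef0 !mcoeff0.
rewrite muniE.
rewrite coef_sum raddf_sum {1}[p]mpolyE raddf_sum /=.
apply: eq_bigr => k _; rewrite coefZ coefXn mcoeffZ mcoeffX.
have -> : (k == m) =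
    ([multinom k (widen i) | i < n] == m') && (m ord_max == k ord_max).
  apply/eqP/andP => [-> //|[/eqP /mnmP eqw /eqP eqm]].
  apply/mnmP => i; case: (unliftP ord_max i) => [j ->|-> //].
  suff <- : widen j = lift ord_max j by have := eqw j; rewrite !mnmE.
  by apply/val_inj; rewrite /= /bump leqNgt ltn_ord.
case: (m ord_max == _); last by rewrite andbF !mulr0 mcoeff0.
by rewrite andbT /= mulr1 mcoeffZ mcoeffX.
Qed.

Lemma meval_muni (n : nat) (K : comNzRingType) (p : {mpoly K[n.+1]})
    (v : 'I_n.+1 -> K) :
  (map_poly (meval (fun i => v (widen i))) (muni p)).[v ord_max] = p.@[v].
Proof.
rewrite muniE mevalE rmorph_sum horner_sum; apply: eq_bigr => m _.
rewrite /= map_polyZ /= map_polyXn hornerZ hornerXn mevalZ mevalX -mulrA.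
congr (_ * _); rewrite big_ord_recr /=; congr (_ * _).
by apply: eq_bigr => i _; rewrite mnmE.
Qed.

(** A nonzero polynomial over an infinite field does not vanish everywhere:
    its leading coefficient in the last variable is, by induction, nonzero at
    some point, above which a nonzero univariate polynomial remains. *)
Lemma mpoly_neq0_meval (K : numFieldType) (n : nat) (p : {mpoly K[n]}) :
  p != 0 -> exists v, p.@[v] != 0.
Proof.
elim: n p => [|n IHn] p pN0.
  exists (fun _ => 0); rewrite -[p]mpolyKC mevalC.
  by apply: contraNneq pN0 => p0; rewrite -[p]mpolyKC p0 mpolyC0.
have lcN0 : lead_coef (muni p) != 0.
  by rewrite lead_coef_eq0; apply: contraNneq pN0 => /muni_eq0 ->.
have [v lcv] := IHn _ lcN0; pose q := map_poly (meval v) (muni p).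
have [|t qt] := @poly_neq0_horner _ q.
  apply: contraNneq lcv => q0; rewrite /lead_coef.
  by have := coef_map (meval v) (muni p) (size (muni p)).-1; rewrite -/q q0 coef0 => <-.
pose w (i : 'I_n.+1) := if unlift ord_max i is Some j then v j else t.
exists w; apply: contraNneq qt => pw0.
rewrite -pw0 -meval_muni /q {2}/w unlift_none; apply/eqP; congr (_.[_]).
apply: eq_map_poly => /= r; apply: meval_eq => i.
suff -> : widen i = lift ord_max i by rewrite /w liftK.
by apply/val_inj; rewrite /= /bump leqNgt ltn_ord.
Qed.

Lemma mpoly_eq0_meval (K : numFieldType) (n : nat) (p : {mpoly K[n]}) :
  (forall v, p.@[v] = 0) -> p = 0.
Proof.
move=> p0; apply/eqP/negPn/negP => /mpoly_neq0_meval[v].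
by rewrite p0 eqxx.
Qed.

(** * Definable sets over an algebraically closed field *)

Section DefinableSets.

Variable K : numClosedFieldType.
Implicit Types (t : GRing.term K) (f : GRing.formula K).

(** The inverse symbol is sent to an arbitrary polynomial: only terms in the
    language of rings are interpreted. *)
Fixpoint mpoly_of_term (n : nat) t : {mpoly K[n]} :=
  match t with
  | GRing.Var i => if insub i is Some j then 'X_j else 0
  | GRing.Const c => c%:MP
  | GRing.NatConst m => m%:R
  | GRing.Add t1 t2 => mpoly_of_term n t1 + mpoly_of_term n t2
  | GRing.Opp t1 => - mpoly_of_term n t1
  | GRing.NatMul t1 m => mpoly_of_term n t1 *+ m
  | GRing.Mul t1 t2 => mpoly_of_term n t1 * mpoly_of_term n t2
  | GRing.Inv t1 => 0
  | GRing.Exp t1 m => mpoly_of_term n t1 ^+ m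
  end.

Lemma nth_codom_ord (n : nat) (x : 'I_n -> K) (i : 'I_n) : (codom x)`_i = x i.
Proof. by rewrite (nth_map i) ?size_enum_ord // nth_ord_enum. Qed.

Lemma meval_mpoly_of_term (n : nat) t (x : 'I_n -> K) :
  GRing.rterm t -> (mpoly_of_term n t).@[x] = GRing.eval (codom x) t.
Proof.
elim: t => //= [i|c|m|t1 IH1 t2 IH2|t1 IH1|t1 IH1 m|t1 IH1 t2 IH2|t1 IH1 m].
- move=> _; case: insubP => [j _ <-|]; first by rewrite mevalXU nth_codom_ord.
  by rewrite -leqNgt => le_n; rewrite meval0 nth_default // size_codom card_ord.
- by move=> _; rewrite mevalC.
- by move=> _; rewrite rmorph_nat.
- by case/andP=> /IH1 <- /IH2 <-; rewrite mevalD.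
- by move/IH1 <-; rewrite mevalN.
- by move/IH1 <-; rewrite mevalMn.
- by case/andP=> /IH1 <- /IH2 <-; rewrite mevalM.
- by move/IH1 <-; rewrite rmorphXn.
Qed.

(** Since the ring of polynomials is an integral domain, the conditions imposed
    by the finitely many atoms multiply to one nonzero polynomial. *)
Lemma qf_eval_generically_constant (n : nat) f :
    GRing.qf_form f -> GRing.rformula f ->
  exists b : bool, exists2 h : {mpoly K[n]}, h != 0 &
    forall x, h.@[x] != 0 -> GRing.qf_eval (codom x) f = b.
Proof.
have both f1 f2 (op : bool -> bool -> bool) :
    (exists b : bool, exists2 h : {mpoly K[n]}, h != 0 &
      forall x, h.@[x] != 0 -> GRing.qf_eval (codom x) f1 = b) ->
    (exists b : bool, exists2 h : {mpoly K[n]}, h != 0 &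
      forall x, h.@[x] != 0 -> GRing.qf_eval (codom x) f2 = b) ->
  exists b : bool, exists2 h : {mpoly K[n]}, h != 0 &
    forall x, h.@[x] != 0 ->
      op (GRing.qf_eval (codom x) f1) (GRing.qf_eval (codom x) f2) = b.
  move=> [b1 [h1 h1N0 H1]] [b2 [h2 h2N0 H2]]; exists (op b1 b2).
  exists (h1 * h2); first by rewrite mulf_neq0.
  by move=> x; rewrite mevalM mulf_eq0 negb_or => /andP[/H1 -> /H2 ->].
have one0 : (1 : {mpoly K[n]}) != 0 by rewrite oner_neq0.
elim: f => //=.
- by move=> b _ _; exists b, 1.
- move=> t1 t2 _ /andP[r1 r2]; set h := mpoly_of_term n t1 - mpoly_of_term n t2.
  have evE x : (GRing.eval (codom x) t1 == GRing.eval (codom x) t2)%bool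
      = (h.@[x] == 0)%bool.
    by rewrite -!meval_mpoly_of_term // -subr_eq0 mevalB.
  have [h0|hN0] := eqVneq h 0.
    by exists true, 1 => // x _; rewrite evE h0 meval0 eqxx.
  by exists false, h => // x /negPf; rewrite evE.
- move=> f1 IH1 f2 IH2 /andP[q1 q2] /andP[r1 r2].
  exact: (both f1 f2 andb (IH1 q1 r1) (IH2 q2 r2)).
- move=> f1 IH1 f2 IH2 /andP[q1 q2] /andP[r1 r2].
  exact: (both f1 f2 orb (IH1 q1 r1) (IH2 q2 r2)).
- move=> f1 IH1 f2 IH2 /andP[q1 q2] /andP[r1 r2].
  exact: (both f1 f2 implb (IH1 q1 r1) (IH2 q2 r2)).
- move=> f1 IH1 q1 r1; have [b [h hN0 H]] := IH1 q1 r1.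
  by exists (~~ b), h => // x /H ->.
Qed.

(** Quantifier elimination reduces this to formulas without quantifiers. *)
Lemma definable_generically_constant (n : nat) f : GRing.rformula f ->
  exists2 h : {mpoly K[n]}, h != 0 &
    (forall x, h.@[x] != 0 -> GRing.holds (codom x) f) \/
    (forall x, h.@[x] != 0 -> ~ GRing.holds (codom x) f).
Proof.
move=> rf; have wf := @ClosedFieldQE.wf_ex_elim K.
have ok := ClosedFieldQE.holds_ex_elim (@GRing.solve_monicpoly K).
have /andP[qg rg] := GRing.quantifier_elim_wf wf rf.
have [b [h hN0 H]] := qf_eval_generically_constant n qg rg.
exists h => //; case: b H => H; [left|right] => x /H hx;
  have := GRing.quantifier_elim_rformP wf ok (codom x) rf; rewrite hx.
  by move/elimT; apply.
by move/elimF; apply.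
Qed.

(** The shift s leaves the first s variables of a formula to other uses. *)
Definition term_of_mpoly (N s : nat) (p : {mpoly K[N]}) : GRing.term K :=
  \big[GRing.Add/GRing.Const 0]_(m <- msupp p)
    GRing.Mul (GRing.Const p@_m)
      (\big[GRing.Mul/GRing.Const 1]_(i < N)
         GRing.Exp (GRing.Var K (s + i)) (m i)).

Lemma rterm_term_of_mpoly (N s : nat) (p : {mpoly K[N]}) :
  GRing.rterm (term_of_mpoly s p).
Proof.
apply: (big_ind (@GRing.rterm K)) => //= [t1 t2 -> -> //|m _].
by apply: (big_ind (@GRing.rterm K)) => //= t1 t2 -> ->.
Qed.

Lemma eval_term_of_mpoly (N s : nat) (p : {mpoly K[N]}) (e : seq K) :
  GRing.eval e (term_of_mpoly s p) = p.@[fun i => e`_(s + i)].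
Proof.
rewrite mevalE (big_morph (GRing.eval e) (id1 := 0) (op1 := +%R)) //=.
apply: eq_bigr => m _; congr (_ * _).
by rewrite (big_morph (GRing.eval e) (id1 := 1) (op1 := *%R)).
Qed.

(** The image of a polynomial map is definable, by a formula with one
    existential quantifier for each coordinate of the source. *)
Lemma image_dense_or_in_hypersurface (n N : nat) (Phi : 'I_n -> {mpoly K[N]}) :
  exists2 h : {mpoly K[n]}, h != 0 &
    (forall x, h.@[x] != 0 -> exists y, forall j, x j = (Phi j).@[y]) \/
    (forall y, h.@[fun j => (Phi j).@[y]] = 0).
Proof.
pose body := \big[GRing.And/GRing.Bool true]_(j <- enum 'I_n)
  GRing.Equal (GRing.Var K j) (term_of_mpoly n (Phi j)).
pose f := foldr (@GRing.Exists K) body (iota n N).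
have rbody : GRing.rformula body.
  apply: (big_ind (@GRing.rformula K)) => //= [g1 g2 -> -> //|j _].
  exact: rterm_term_of_mpoly.
have rf : GRing.rformula f by rewrite /f; elim: (iota n N).
have bodyP e : GRing.holds e body <->
    forall j : 'I_n, e`_j = (Phi j).@[fun i => e`_(n + i)].
  rewrite /body; split.
    move=> He j; have : j \in enum 'I_n by rewrite mem_enum.
    elim: (enum 'I_n) He => // i s IHs; rewrite big_cons /= => -[ei es].
    rewrite inE => /predU1P[->|]; last exact: IHs.
    by rewrite ei eval_term_of_mpoly.
  move=> He; apply: (big_ind (GRing.holds e)) => //= j _.
  by rewrite eval_term_of_mpoly.
have fP (x : 'I_n -> K) : GRing.holds (codom x) f <->
    exists y, forall j, x j = (Phi j).@[y].
  split.
    move/GRing.foldExistsP => [e' eqe /bodyP He'].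
    exists (fun i => e'`_(n + i)) => j; rewrite -He' -eqe ?nth_codom_ord //.
    by rewrite !inE mem_iota negb_and -ltnNge ltn_ord.
  move=> [y Hy]; apply/GRing.foldExistsP.
  have size_x : size (codom x) = n by rewrite size_codom card_ord.
  exists (codom x ++ codom y) => [i|].
    rewrite !inE mem_iota nth_cat size_x negb_and -ltnNge -leqNgt.
    case: (ltnP i n) => //= ni nNi; rewrite !nth_default ?size_x //.
    by rewrite size_codom card_ord leq_subRL.
  apply/bodyP => j; rewrite nth_cat size_x ltn_ord nth_codom_ord Hy.
  apply: meval_eq => i; rewrite nth_cat size_x ltnNge leq_addr /= addKn.
  by rewrite nth_codom_ord.
have [h hN0 H] := definable_generically_constant n rf; exists h => //.
case: H => H; [left => x /H /fP // | right => y].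
apply/eqP/negPn/negP => /H; apply; apply/fP; by exists y.
Qed.

End DefinableSets.

(** * Quadratic maps with a surjective differential *)

Lemma mcoeff_pihomog (n : nat) (K : nzRingType) (d : nat) (p : {mpoly K[n]})
    (m : 'X_{1..n}) :
  (pihomog mdeg d p)@_m = if mdeg m == d then p@_m else 0.
Proof.
rewrite {2}[p]mpolyE pihomogE !raddf_sum /= big_mkcond /=.
have [<-|mN] := eqVneq; last first.
  rewrite big1 // => k _; case: eqP => // kd.
  rewrite mcoeffZ mcoeffX; case: eqP => [km|_]; last by rewrite mulr0.
  by rewrite -km kd eqxx in mN.
apply: eq_bigr => k _; case: eqP => // kN.
rewrite mcoeffZ mcoeffX; case: eqP => [km|_]; last by rewrite mulr0.
by rewrite km in kN.
Qed.

(** Near the point c, the lowest form of h decides: if every direction a is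
    tangent at c to a curve c + t a + t^2 b on which h vanishes, the leading
    coefficient in t shows that this form vanishes at every a. *)
Lemma eq0_on_tangent_curves (K : numFieldType) (n : nat) (h : {mpoly K[n]})
    (c : 'I_n -> K) :
  (forall a : 'I_n -> K, exists b : 'I_n -> K,
    forall t, h.@[fun i => c i + t * a i + t ^+ 2 * b i] = 0) ->
  h = 0.
Proof.
move=> curve; pose g := h \mPo [tuple 'X_i + (c i)%:MP | i < n].
have gE v : g.@[v] = h.@[fun i => v i + c i].
  rewrite comp_mpoly_meval; apply: meval_eq => i.
  by rewrite tnth_mktuple mevalD mevalXU mevalC.
have [g0|gN0] := eqVneq g 0.
  apply: mpoly_eq0_meval => v.
  rewrite -(meval0 (fun i => v i - c i)) -g0 gE.
  by apply: meval_eq => i; rewrite subrK.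
have : exists k, pihomog mdeg k g != 0.
  exists (mdeg (mlead g)); apply: contraNneq gN0 => gk0.
  by rewrite -mleadc_eq0 -(mcoeff0 _ (mlead g)) -gk0 mcoeff_pihomog eqxx.
case/ex_minnP=> k gkN0 kmin.
have supp_ge m : m \in msupp g -> (k <= mdeg m)%N.
  rewrite mcoeff_msupp => gmN0; apply: kmin; apply: contraNneq gmN0 => gk0.
  by rewrite -(mcoeff0 _ m) -gk0 mcoeff_pihomog eqxx.
case/eqP: gkN0; apply: mpoly_eq0_meval => a; have [b hb] := curve a.
(* The value of g on the curve is t^k P(t), and P(0) is the value at a of the
   lowest form of g. *)
pose P : {poly K} := \sum_(m <- msupp g)
  g@_m *: ('X^(mdeg m - k) * \prod_i ((a i)%:P + b i *: 'X) ^+ m i).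
have PE : 'X^k * P = 0 -> P = 0.
  by move/eqP; rewrite mulf_eq0 expf_eq0 polyX_eq0 andbF => /eqP.
have P0 : P = 0.
  apply: PE; apply: poly_eq0_horner => t.
  have <- : g.@[fun i => t * a i + t ^+ 2 * b i] = 0.
    rewrite gE -[RHS](hb t); apply: meval_eq => i.
    by rewrite [_ + c i]addrC addrA.
  rewrite mevalE hornerM hornerXn horner_sum mulr_sumr.
  rewrite big_seq [RHS]big_seq; apply: eq_bigr => m mg.
  rewrite hornerZ hornerM hornerXn mulrCA mulrA -[_ * _ * _]mulrA.
  rewrite mulrA -mulrA [t ^+ k * _]mulrA -exprD subnKC ?supp_ge //.
  congr (_ * _); rewrite mdegE expr_sum horner_prod -big_split /=.
  apply: eq_bigr => i _; rewrite horner_exp hornerD hornerC hornerZ hornerX.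
  by rewrite -exprMn; congr (_ ^+ _); ring.
have := congr1 (horner^~ 0) P0; rewrite horner0 horner_sum => P00.
rewrite -[RHS]P00 pihomogE raddf_sum /= big_mkcond /= big_seq [RHS]big_seq.
apply: eq_bigr => m mg.
rewrite hornerZ hornerM hornerXn expr0n subn_eq0.
rewrite [(mdeg m <= k)%N]leq_eqVlt ltnNge supp_ge // orbF.
case: (mdeg m == k); last by rewrite mul0r mulr0.
rewrite mul1r mevalZ mevalX horner_prod; congr (_ * _).
apply: eq_bigr => i _.
by rewrite horner_exp hornerD hornerC hornerZ hornerX mulr0 addr0.
Qed.

(** The differential at u0 of the quadratic map u |-> B u u is
    u |-> B u0 u + B u u0. When it is surjective, the curves
    t |-> B (u0 + t u) (u0 + t u) are tangent to all directions, so the image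
    lies in no hypersurface. *)
Lemma for_general_quadratic (K : numClosedFieldType) (U W : vectType K)
    (B : U -> U -> W) (u0 : U) :
    (forall u, linear (B u)) -> (forall v, linear (B^~ v)) ->
    (forall w, exists u, B u0 u + B u u0 = w) ->
  for_general (fun w => exists u, w = B u u).
Proof.
move=> Br Bl Bsurj.
have BDr u v v' : B u (v + v') = B u v + B u v'.
  by have := Br u 1 v v'; rewrite !scale1r.
have BDl u u' v : B (u + u') v = B u v + B u' v.
  by have := Bl v 1 u u'; rewrite !scale1r.
have B0r u : B u 0 = 0 by apply: (addrI (B u 0)); rewrite -BDr !addr0.
have B0l v : B 0 v = 0 by apply: (addrI (B 0 v)); rewrite -BDl !addr0.
have BZr u c v : B u (c *: v) = c *: B u v.
  by have := Br u c v 0; rewrite !addr0 B0r addr0.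
have BZl c u v : B (c *: u) v = c *: B u v.
  by have := Bl v c u 0; rewrite !addr0 B0l addr0.
pose n := \dim {:W}; pose N := \dim {:U}.
pose e (i : 'I_N) : U := (vbasis {:U})`_i.
pose cW (j : 'I_n) (w : W) : K := coord (vbasis {:W}) j w.
pose Phi (j : 'I_n) : {mpoly K[N]} :=
  \sum_(i < N) \sum_(k < N) cW j (B (e i) (e k)) *: ('X_i * 'X_k).
have PhiE y j : (Phi j).@[y] =
    cW j (B (\sum_i y i *: e i) (\sum_k y k *: e k)).
  rewrite (big_morph (B^~ _) (fun u u' => BDl u u' _) (B0l _)) /=.
  rewrite raddf_sum /= /cW raddf_sum; apply: eq_bigr => i _ /=.
  rewrite BZl (big_morph (B _) (BDr _) (B0r _)) scaler_sumr.
  rewrite !raddf_sum; apply: eq_bigr => k _ /=.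
  rewrite mevalZ mevalM !mevalXU BZr !linearZ /=.
  by rewrite mulrC mulrA.
have coordU u : \sum_i coord (vbasis {:U}) i u *: e i = u.
  by rewrite -(coord_vbasis (memvf u)).
have [h hN0 [dense|hyp]] := image_dense_or_in_hypersurface Phi.
  exists (fun w => h.@[cW^~ w] != 0); split.
  - exists (fun P => P = h) => w; split => [hw P ->|/(_ _ erefl) hw].
      by apply/eqP/negPn/negP.
    by rewrite [h.@[_]]hw eqxx.
  - have [x hx] := mpoly_neq0_meval hN0.
    exists (\sum_j x j *: (vbasis {:W})`_j).
    have -> // : h.@[cW^~ (\sum_j x j *: (vbasis {:W})`_j)] = h.@[x].
    apply: meval_eq => j; rewrite /cW coord_sum_free //.
    exact: basis_free (vbasisP _).
  - move=> w /dense[y Hy]; exists (\sum_i y i *: e i).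
    rewrite (coord_vbasis (memvf w)) [RHS](coord_vbasis (memvf _)).
    by apply: eq_bigr => j _; rewrite -/(cW j w) Hy PhiE.
case/eqP: hN0; apply: (@eq0_on_tangent_curves _ _ _ (cW^~ (B u0 u0))) => a.
have [u hu] := Bsurj (\sum_j a j *: (vbasis {:W})`_j).
exists (cW^~ (B u u)) => t.
rewrite -[RHS](hyp (fun i => coord (vbasis {:U}) i (u0 + t *: u))).
apply: meval_eq => j; rewrite PhiE !coordU BDr !BDl !BZr !BZl.
have -> : a j = cW j (B u0 u + B u u0).
  by rewrite hu /cW coord_sum_free // (basis_free (vbasisP _)).
rewrite /cW !linearD /= !linearZ /=; ring.
Qed.

(** * Directional derivatives *)

Section DirectionalDerivatives.

Variables (K : numFieldType) (n : nat).
Implicit Types (u v l : 'rV[K]_n) (p q : {mpoly K[n]}).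

Definition dderiv v p : {mpoly K[n]} := \sum_i v 0 i *: p^`M(i).

Definition linear_form l : {mpoly K[n]} := \sum_i l 0 i *: 'X_i.

Definition dot v l : K := \sum_i v 0 i * l 0 i.

Lemma dderiv_is_linear v : linear (dderiv v).
Proof.
move=> c p q; rewrite /dderiv scaler_sumr -big_split /=; apply: eq_bigr => i _.
by rewrite linearP /= scalerDr !scalerA mulrC.
Qed.

HB.instance Definition _ v :=
  GRing.isLinear.Build K {mpoly K[n]} {mpoly K[n]} _ (dderiv v)
    (dderiv_is_linear v).

Lemma dderivM v p q : dderiv v (p * q) = dderiv v p * q + p * dderiv v q.
Proof.
rewrite /dderiv mulr_suml mulr_sumr -big_split /=; apply: eq_bigr => i _.
by rewrite mderivM scalerDr -scalerAl -scalerAr.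
Qed.

Lemma dderivC u v p : dderiv u (dderiv v p) = dderiv v (dderiv u p).
Proof.
rewrite [dderiv v p]/dderiv [dderiv u p in RHS]/dderiv !linear_sum /=.
rewrite /dderiv exchange_big /=; apply: eq_bigr => i _; apply: eq_bigr => j _.
by rewrite !linearZ /= !scalerA mulrC mderiv_comm.
Qed.

Lemma mderiv_linear_form i l : (linear_form l)^`M(i) = (l 0 i)%:MP.
Proof.
apply/mpolyP => m; rewrite mcoeff_mderiv mcoeffC raddf_sum /= (bigD1 i) //=.
rewrite mcoeffZ mcoeffX big1 ?addr0 => [|j ji]; last first.
  rewrite mcoeffZ mcoeffX; case: eqP => [/mnmP/(_ i)|]; last by rewrite mulr0.
  by rewrite mnmDE !mnm1E (negPf ji) eqxx addn1.
have [->|mN0] := eqVneq m 0%MM; first by rewrite add0m eqxx mnm0E.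
rewrite [_ == _](_ : _ = false) ?mulr0 ?mul0rn //.
apply: contraNF mN0 => /eqP /mnmP mi; apply/eqP/mnmP => j; rewrite mnm0E.
by apply: (@addIn (U_(i)%MM j)); rewrite -mnmDE -mi.
Qed.

Lemma dderiv_linear_form v l : dderiv v (linear_form l) = (dot v l)%:MP.
Proof.
rewrite /dderiv /dot raddf_sum /=; apply: eq_bigr => i _.
by rewrite mderiv_linear_form -mul_mpolyC -mpolyCM.
Qed.

Lemma dderivX v p e : dderiv v (p ^+ e.+1) = (e.+1%:R : K) *: (p ^+ e * dderiv v p).
Proof.
elim: e => [|e IHe]; first by rewrite expr1 expr0 mul1r scale1r.
rewrite exprS dderivM IHe -scalerAr mulrA -exprS mulrC.
by rewrite -[in RHS]nat1r scalerDl scale1r.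
Qed.

Lemma linear_form_homog l : linear_form l \is 1.-homog.
Proof. by apply: rpred_sum => i _; rewrite rpredZ // dhomogX /= mdeg1. Qed.

Lemma dderiv_homog v p d : p \is d.+1.-homog -> dderiv v p \is d.-homog.
Proof.
move=> hp; apply: rpred_sum => i _; apply: rpredZ; apply/dhomogP => m.
rewrite mcoeff_msupp mcoeff_mderiv => cN0.
have : (m + U_(i))%MM \in msupp p.
  by rewrite mcoeff_msupp; apply: contraNneq cN0 => ->; rewrite mul0rn.
by move/(dhomog_mf hp); rewrite /= mdegD mdeg1 addn1 => -[].
Qed.

Lemma dderiv_homog0 v p : p \is 0.-homog -> dderiv v p = 0.
Proof.
move=> hp; apply: big1 => i _; suff -> : p^`M(i) = 0 by rewrite scaler0.
apply/mpolyP => m; rewrite mcoeff_mderiv mcoeff0 (dhomog_nemf_coeff hp) ?mul0rn //.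
by rewrite /= mdegD mdeg1 addn1.
Qed.

Lemma eq0_all_mderiv p d :
  p \is d.+1.-homog -> (forall i, p^`M(i) = 0) -> p = 0.
Proof.
move=> hp dp; apply/mpolyP => m; rewrite mcoeff0.
have [|mN] := eqVneq (mdeg m) d.+1; last exact: dhomog_nemf_coeff hp mN.
move=> dm; have [i mi] : exists i, m i != 0%N.
  apply/existsP; apply: contra_eqT dm; rewrite negb_exists => /forallP m0.
  by rewrite mdegE big1 // => i _; apply/eqP; have := m0 i; rewrite negbK.
have /eqP := congr1 (mcoeff (m - U_(i))) (dp i).
rewrite mcoeff_mderiv mcoeff0 submK; last first.
  by apply/mnm_lepP => j; rewrite mnm1E; case: eqP => // <-; rewrite lt0n.
by rewrite Num.Theory.mulrn_eq0 /= => /eqP.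
Qed.

(** * Forms killed by a set of derivations *)

Definition killed (vs : seq 'rV[K]_n) p := forall v, v \in vs -> dderiv v p = 0.

Lemma killed_cons v vs p :
  killed (v :: vs) p <-> dderiv v p = 0 /\ killed vs p.
Proof.
split=> [kp|[vp kp] w]; last by rewrite inE => /predU1P[->|/kp].
by split=> [|w w_vs]; apply: kp; rewrite inE ?eqxx ?w_vs ?orbT.
Qed.

Lemma killed0 vs : killed vs 0.
Proof. by move=> v _; rewrite linear0. Qed.

Lemma killedD vs p q : killed vs p -> killed vs q -> killed vs (p + q).
Proof. by move=> kp kq v vv; rewrite linearD /= kp // kq // addr0. Qed.

Lemma killedZ vs c p : killed vs p -> killed vs (c *: p).
Proof. by move=> kp v vv; rewrite linearZ /= kp // scaler0. Qed.

Lemma killedM vs p q : killed vs p -> killed vs q -> killed vs (p * q).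
Proof. by move=> kp kq v vv; rewrite dderivM kp // kq // mul0r mulr0 addr0. Qed.

Lemma killedX vs p e : killed vs p -> killed vs (p ^+ e).
Proof.
move=> kp; elim: e => [|e IHe]; last by rewrite exprS; apply: killedM.
by move=> v _; apply: dderiv_homog0; rewrite expr0 dhomog1.
Qed.

Lemma killed_dderiv vs v p : killed vs p -> killed vs (dderiv v p).
Proof. by move=> kp u /kp up; rewrite dderivC up linear0. Qed.

(** Integration by parts. The solution is the finite sum of the terms
    (-1)^k l^k g^(k) / (e+1)...(e+1+k), where g^(k) is the k-th derivative of
    g and l is normalized so that its derivative is 1. *)
Lemma dderiv_antiderivative vs v l e d g :
    dot v l != 0 -> killed vs (linear_form l) ->
    killed vs g -> g \is d.-homog ->
  exists s, [/\ killed vs s, s \is d.-homog &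
    dderiv v (linear_form l ^+ e.+1 * s) = linear_form l ^+ e * g].
Proof.
move=> cN0 kl; set c := dot v l in cN0 *; set L := linear_form l in kl *.
have dL : dderiv v L = c%:MP := dderiv_linear_form v l.
have ec e' : (e'.+1%:R * c : K) != 0.
  by rewrite mulf_neq0 // Num.Theory.pnatr_eq0.
have dLX e' : dderiv v (L ^+ e'.+1) = (e'.+1%:R * c) *: L ^+ e'.
  by rewrite dderivX dL mulrC mul_mpolyC scalerA.
elim: d e g => [|d IHd] e g kg hg.
  exists ((e.+1%:R * c)^-1 *: g); split; [exact: killedZ|exact: rpredZ|].
  rewrite dderivM dLX linearZ /= (dderiv_homog0 v hg) scaler0 mulr0 addr0.
  by rewrite -scalerAl -scalerAr scalerA divff ?scale1r.
have [s [ks hs ds]] := IHd e.+1 _ (killed_dderiv v kg) (dderiv_homog v hg).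
exists ((e.+1%:R * c)^-1 *: (g - L * s)); split.
- apply: killedZ; apply: killedD => //; rewrite -scaleN1r; apply: killedZ.
  exact: killedM.
- by apply: rpredZ; rewrite rpredB // -[d.+1]add1n dhomogM // linear_form_homog.
rewrite -scalerAr linearZ /= mulrBr mulrA -exprSr linearB /= ds dderivM dLX.
by rewrite addrK -scalerAl scalerA mulVf ?scale1r.
Qed.

Section Ideals.

Variables (I : finType) (form : I -> 'rV[K]_n).
Implicit Types (S : pred I) (e : I -> nat) (vs : seq 'rV[K]_n).

Local Notation lf i := (linear_form (form i)).

(** The degree d part of the ideal that the powers lf i ^+ e i, for i in S,
    generate in the graded ring of the polynomials killed by vs. Building the
    members term by term allows them to be integrated term by term, without a
    simultaneous choice of cofactors. *)
Inductive in_ideal vs S e (d : nat) : {mpoly K[n]} -> Prop :=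
| in_ideal0 : in_ideal vs S e d 0
| in_idealD i s k p : S i -> killed vs s -> s \is k.-homog -> (e i + k = d)%N ->
    in_ideal vs S e d p -> in_ideal vs S e d (lf i ^+ e i * s + p).

Definition filled vs S e d :=
  forall p, killed vs p -> p \is d.-homog -> in_ideal vs S e d p.

Lemma in_ideal_add vs S e d p q :
  in_ideal vs S e d p -> in_ideal vs S e d q -> in_ideal vs S e d (p + q).
Proof.
move=> Ip Iq; elim: Ip => [|i s k r Si ks hs ek _ IH]; first by rewrite add0r.
by rewrite -addrA; apply: in_idealD hs ek IH.
Qed.

Lemma in_ideal_sub vs vs' S S' e d p :
    {subset vs' <= vs} -> (forall i, S i -> S' i) ->
  in_ideal vs S e d p -> in_ideal vs' S' e d p.
Proof.
move=> sub_vs sub_S; elim=> [|i s k r Si ks hs ek _ IH]; first exact: in_ideal0.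
by apply: in_idealD hs ek IH => [|v /sub_vs /ks //]; apply: sub_S.
Qed.

Lemma in_ideal_homog vs S e d p : in_ideal vs S e d p -> p \is d.-homog.
Proof.
elim=> [|i s k r Si ks hs ek _ IH]; first exact: rpred0.
apply: rpredD IH; rewrite -ek dhomogM //.
by have := dhomogMn (e i) (linear_form_homog (form i)); rewrite mul1n.
Qed.

Lemma in_ideal_killed vs S e d p :
    (forall i, S i -> killed vs (lf i)) -> in_ideal vs S e d p -> killed vs p.
Proof.
move=> kS; elim=> [|i s k r Si ks hs ek _ IH]; first exact: killed0.
by apply: killedD IH; apply: killedM ks; apply: killedX (kS i Si).
Qed.

Lemma in_ideal_sum vs S e d p : in_ideal vs S e d p ->
  exists2 s : I -> {mpoly K[n]}, (forall i, s i \is (d - e i).-homog) &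
    p = \sum_i lf i ^+ e i * s i.
Proof.
elim=> [|i s k r Si ks hs ek _ [t ht ->]].
  by exists (fun _ => 0) => [i|]; rewrite ?rpred0 // big1 // => i _; rewrite mulr0.
exists (fun j => (if j == i then s else 0) + t j) => [j|].
  by case: eqP => [->|_]; rewrite rpredD ?rpred0 // -ek addKn.
rewrite [LHS]addrC [in RHS](eq_bigr _ (fun j _ => mulrDr _ _ _)) big_split /=.
rewrite addrC; congr (_ + _).
by rewrite (bigD1 i) //= eqxx big1 ?addr0 // => j /negPf ->; rewrite mulr0.
Qed.

Lemma filled_exp0 vs S e d i : S i -> e i = 0%N -> filled vs S e d.
Proof.
move=> Si e0 p kp hp; have -> : p = lf i ^+ e i * p + 0 by rewrite e0 mul1r addr0.
by apply: in_idealD Si kp hp _ _; rewrite ?e0 //; apply: in_ideal0.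
Qed.

Lemma filled_sub vs S S' e d : (forall i, S i -> S' i) ->
  filled vs S e d -> filled vs S' e d.
Proof. by move=> SS' fS p kp hp; apply: in_ideal_sub (fS p kp hp). Qed.

Definition lower v e : I -> nat :=
  fun i => if dot v (form i) == 0 then e i else (e i).-1.

(** To reach p, reach its derivative along v first and integrate; what remains
    is killed by v. Integrating a multiple of lf i ^+ (e i).-1 gives a multiple
    of lf i ^+ e i when v does not kill lf i, so that the exponents which count
    for the derivative are the lowered ones. *)
Lemma filled_step vs v t S e d :
    (forall i, S i -> killed vs (lf i)) ->
    killed vs (linear_form t) -> dot v t != 0 ->
    (forall i, S i -> (0 < e i)%N) ->
    filled (v :: vs) S e d.+1 -> filled vs S (lower v e) d ->
  filled vs S e d.+1.
Proof.
move=> kS kt vt e_gt0 fill_ker fill_deriv p kp hp.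
have [q Iq dq] : exists2 q, in_ideal vs S e d.+1 q & dderiv v q = dderiv v p.
  (* The derivative is integrated term by term; t serves to integrate a cofactor
     when v kills the form itself. *)
  elim: (fill_deriv _ (killed_dderiv v kp) (dderiv_homog v hp)).
    by exists 0; [exact: in_ideal0 | rewrite linear0].
  move=> i s k r Si ks hs; rewrite /lower; have [vi0|viN0] := eqVneq.
    move=> ek _ [q Iq <-].
    have [s' [ks' hs' ds']] := dderiv_antiderivative 0 vt kt ks hs.
    exists (lf i ^+ e i * (linear_form t * s') + q).
      apply: in_idealD Si _ _ _ Iq; first exact: killedM.
        by apply: dhomogM hs'; apply: linear_form_homog.
      by rewrite add1n addnS ek.
    rewrite linearD /= dderivM -[linear_form t]expr1 ds' expr0 mul1r.
    case: (e i) (e_gt0 i Si) => // ei _.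
    by rewrite dderivX dderiv_linear_form vi0 mpolyC0 mulr0 scaler0 mul0r add0r.
  case eiE: (e i) (e_gt0 i Si) => [//|ei] _ /= ek _ [q Iq <-].
  have [s' [ks' hs' ds']] := dderiv_antiderivative ei viN0 (kS i Si) ks hs.
  exists (lf i ^+ e i * s' + q); last by rewrite linearD /= eiE ds'.
  by apply: in_idealD Si ks' hs' _ Iq; rewrite eiE addSn ek.
have kq := in_ideal_killed kS Iq.
rewrite -[p](subrK q); apply: (in_ideal_add _ Iq).
apply: (@in_ideal_sub (v :: vs) _ S) => // [w w_vs|]; first by rewrite inE w_vs orbT.
apply: fill_ker; last by rewrite rpredB // (in_ideal_homog Iq).
apply/killed_cons; split; first by rewrite linearB /= dq subrr.
by rewrite -scaleN1r; apply: killedD kp _; apply: killedZ.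
Qed.

(** * Points, lines, planes and space *)

(** Stated through its effect on polynomials: by Euler's formula, it holds when
    vs spans the space of all derivations with constant coefficients. *)
Definition spanning vs :=
  forall p d, killed vs p -> p \is d.+1.-homog -> p = 0.

(** The forms of degree d killed by vs are here the multiples of (lf i)^d; this
    is obtained by differentiating along v down to degree 0. *)
Lemma filled_point vs v (i : I) e d :
    spanning (v :: vs) -> killed vs (lf i) -> dot v (form i) != 0 ->
  (e i <= d)%N -> filled vs (pred1 i) e d.
Proof.
move=> sp ki vi; elim: d e => [|d IHd] e ei.
  by apply: (@filled_exp0 _ _ _ _ i); rewrite /= ?eqxx //; move: ei; case: (e i).
have [e0|e_gt0] := posnP (e i); first by apply: (@filled_exp0 _ _ _ _ i) => /=.
apply: (filled_step (v := v) (t := form i)) => //.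
- by move=> j /eqP ->.
- by move=> j /eqP ->.
- by move=> p kp hp; rewrite (sp _ _ kp hp); apply: in_ideal0.
- by apply: IHd; rewrite /lower (negPf vi); case: (e i) ei.
Qed.

(** The exponents of the two forms of a pair may have sum d + 1: in degree d,
    the ideal of u^a and v^b contains all binary forms once a + b <= d + 1. *)
Definition fills (sigma : I -> I) vs S := forall d e,
  (forall i, S i -> (e i + e (sigma i) <= d.+1)%N) -> filled vs S e d.

(** Differentiating along v1 lowers e (sigma i) and d. What v1 kills is the
    subject of [filled_point], which needs e i <= d: this follows from the bound
    on the sum as soon as e (sigma i) is positive. *)
Lemma fills_line sigma vs v0 v1 i :
    spanning [:: v0, v1 & vs] ->
    killed vs (lf i) -> killed vs (lf (sigma i)) ->
    dot v1 (form i) = 0 -> dot v1 (form (sigma i)) != 0 ->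
    dot v0 (form i) != 0 ->
  fills sigma vs (pred2 i (sigma i)).
Proof.
move=> sp ki kj v1i v1j v0i d e adm.
have {adm} : (e i + e (sigma i) <= d.+1)%N by apply: adm; rewrite /= eqxx.
set j := sigma i in kj v1j *; elim: d e => [|d IHd] e sum_le.
  have [ei|ei] := posnP (e i); first by apply: (@filled_exp0 _ _ _ _ i); rewrite /= ?eqxx.
  apply: (@filled_exp0 _ _ _ _ j); rewrite /= ?eqxx ?orbT //.
  by move: sum_le; rewrite -(prednK ei) addSn ltnS leqn0 addn_eq0 => /andP[_ /eqP].
have [ei|ei_gt0] := posnP (e i); first by apply: (@filled_exp0 _ _ _ _ i); rewrite /= ?eqxx.
have [ej|ej_gt0] := posnP (e j).
  by apply: (@filled_exp0 _ _ _ _ j); rewrite /= ?eqxx ?orbT.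
apply: (filled_step (v := v1) (t := form j)) => //.
- by move=> k /orP[] /eqP ->.
- by move=> k /orP[] /eqP ->.
- apply: (@filled_sub _ (pred1 i)) => [k /eqP ->|]; first by rewrite /= eqxx.
  apply: (filled_point sp) => //.
    by apply/killed_cons; rewrite dderiv_linear_form v1i mpolyC0.
  by move: sum_le; rewrite -(prednK ej_gt0) addnS ltnS; apply: leq_trans (leq_addr _ _).
- apply: IHd; rewrite /lower v1i eqxx (negPf v1j).
  by move: sum_le; rewrite -{1}(prednK ej_gt0) addnS.
Qed.

(** Differentiating along v1 lowers the degree by 1, leaves the exponents of S1
    and lowers the sums of S2 by 2; along v2 the roles are exchanged. So the
    induction alternates v1 and v2: the family whose turn it is has sums at most
    d + 1, and the other one has sums at most d + 2. *)
Lemma filled_join sigma vs d : forall v1 v2 (S1 S2 : pred I) i1 i2 e,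
    S1 i1 -> S2 i2 ->
    (forall i, S1 i -> S1 (sigma i)) -> (forall i, S2 i -> S2 (sigma i)) ->
    (forall i, S1 i -> killed vs (lf i)) -> (forall i, S2 i -> killed vs (lf i)) ->
    (forall i, S1 i -> dot v1 (form i) = 0) ->
    (forall i, S2 i -> dot v1 (form i) != 0) ->
    (forall i, S2 i -> dot v2 (form i) = 0) ->
    (forall i, S1 i -> dot v2 (form i) != 0) ->
    fills sigma (v1 :: vs) S1 -> fills sigma (v2 :: vs) S2 ->
    (forall i, S1 i -> (e i + e (sigma i) <= d.+1)%N) ->
    (forall i, S2 i -> (e i + e (sigma i) <= d.+2)%N) ->
  filled vs (predU S1 S2) e d.
Proof.
elim: d => [|d IHd] v1 v2 S1 S2 i1 i2 e S1i1 S2i2 S1s S2s k1 k2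
    v1S1 v1S2 v2S2 v2S1 fill1 fill2 le1 le2.
  have := le1 i1 S1i1; case ei: (e i1) => [|k].
    by move=> _; apply: (@filled_exp0 _ _ _ _ i1) => //=; rewrite [S1 i1]S1i1.
  rewrite addSn ltnS leqn0 addn_eq0 => /andP[_ /eqP].
  by apply: filled_exp0; rewrite /= [S1 _]S1s.
have [/existsP[i /andP[Si /eqP ei]]|] :=
    boolP [exists i, predU S1 S2 i && (e i == 0)%N].
  exact: filled_exp0 Si ei.
rewrite negb_exists => /forallP noexp0.
have e_gt0 i : predU S1 S2 i -> (0 < e i)%N.
  by move=> Si; have := noexp0 i; rewrite Si lt0n.
apply: (filled_step (v := v1) (t := form i2)) => //.
- by move=> i /orP[/k1|/k2].
- exact: k2.
- exact: v1S2.
- apply: (@filled_sub _ S1); last exact: fill1.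
  by move=> i S1i; rewrite /= [S1 i]S1i.
apply: (@filled_sub _ (predU S2 S1)) => [i|]; first by rewrite /= orbC.
apply: (IHd v2 v1 S2 S1 i2 i1) => // i Si; rewrite /lower.
  rewrite (negPf (v1S2 _ Si)) (negPf (v1S2 _ (S2s _ Si))).
  have ei : (0 < e i)%N by apply: e_gt0; rewrite /= [S2 i]Si orbT.
  have esi : (0 < e (sigma i))%N.
    by apply: e_gt0; rewrite /= [S2 (sigma i)]S2s ?orbT.
  by have := le2 i Si; rewrite -{1}(prednK ei) -{1}(prednK esi) addSn addnS.
by rewrite !v1S1 ?eqxx ?le1 //; apply: S1s.
Qed.

End Ideals.

End DirectionalDerivatives.

(** * Eight linear forms in four variables *)

Section EightForms.

Variable K : numFieldType.

Definition axis (a : 'I_4) : 'rV[K]_4 := delta_mx 0 a.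

Definition hvar (b : bool) : 'I_4 :=
  @Ordinal 4 (if b then 1 else 0)%N ltac:(by case: b).

Definition lvar (b : bool) : 'I_4 :=
  @Ordinal 4 (if b then 3 else 2)%N ltac:(by case: b).

(** The index (p, l, s) stands for the form x_(1 - p) + (-1)^s x_(2 + l). The
    four forms with given p span the linear forms without x_p, and the two forms
    with given p and l span those without x_p and x_(3 - l). No form lies in both
    three-dimensional spaces, or in both planes of one of them: so each family is
    killed by a partial derivative which kills no form of the other family. *)
Definition eight_form (i : bool * bool * bool) : 'rV[K]_4 :=
  axis (hvar (~~ i.1.1)) + (-1) ^+ i.2 *: axis (lvar i.1.2).

Definition flip (i : bool * bool * bool) : bool * bool * bool := (i.1, ~~ i.2).

Local Notation lf i := (linear_form (eight_form i)).

Lemma dot_axis a (l : 'rV[K]_4) : dot (axis a) l = l 0 a.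
Proof.
rewrite /dot (bigD1 a) //= big1 ?addr0 => [|j ja]; rewrite mxE eqxx /=.
  by rewrite eqxx mul1r.
by rewrite (negPf ja) mul0r.
Qed.

Lemma dderiv_axis a (p : {mpoly K[4]}) : dderiv (axis a) p = p^`M(a).
Proof.
rewrite /dderiv (bigD1 a) //= big1 ?addr0 => [|j ja]; rewrite mxE eqxx /=.
  by rewrite eqxx scale1r.
by rewrite (negPf ja) scale0r.
Qed.

Lemma hvar_or_lvar (a : 'I_4) : (exists b, a = hvar b) \/ (exists b, a = lvar b).
Proof.
case: a => [[|[|[|[|//]]]]] ha; [left; exists false|left; exists true|
  right; exists false|right; exists true]; exact/val_inj.
Qed.

Lemma dot_hvar b i : dot (axis (hvar b)) (eight_form i) = (b != i.1.1)%:R.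
Proof.
rewrite dot_axis !mxE /= -!val_eqE /=.
by case: b i.1.1 i.1.2 => [] [] []; rewrite /= ?mulr0 ?addr0.
Qed.

Lemma dot_lvar b i :
  dot (axis (lvar b)) (eight_form i) = (b == i.1.2)%:R * (-1) ^+ i.2.
Proof.
rewrite dot_axis !mxE /= -!val_eqE /=.
by case: b i.1.1 i.1.2 => [] [] []; rewrite /= ?mulr0 ?mul0r ?mulr1 ?mul1r ?addr0 ?add0r.
Qed.

Lemma dotBl (u v l : 'rV[K]_4) : dot (u - v) l = dot u l - dot v l.
Proof. by rewrite /dot -sumrB; apply: eq_bigr => i _; rewrite !mxE mulrBl. Qed.

Lemma killed_linear_form (vs : seq 'rV[K]_4) l :
  (forall v, v \in vs -> dot v l = 0) -> killed vs (linear_form l).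
Proof. by move=> h v /h dv; rewrite dderiv_linear_form dv. Qed.

Lemma fills_eight_line p l :
  fills eight_form flip [:: axis (lvar (~~ l)); axis (hvar p)]
    [pred i | i.1 == (p, l)].
Proof.
move=> d e adm.
apply: (@filled_sub _ _ _ _ _ (pred2 (p, l, false) (flip (p, l, false)))).
  by move=> i /orP[] /eqP ->; rewrite /= eqxx.
have ki i : i.1 = (p, l) ->
    killed [:: axis (lvar (~~ l)); axis (hvar p)] (lf i).
  move=> il; apply: killed_linear_form => v; rewrite !inE => /orP[] /eqP ->.
    by rewrite dot_lvar il /=; case: (l); rewrite /= mul0r.
  by rewrite dot_hvar il /= eqxx.
(* x_(1 - p) + x_(2 + l) is killed by the difference of the partial derivatives
   along its two variables, and the other form of the pair is not. *)
apply: (@fills_line _ _ _ _ _ _ (axis (lvar l))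
  (axis (hvar (~~ p)) - axis (lvar l))); first 1 last.
- exact: ki.
- exact: ki.
- by rewrite dotBl dot_hvar dot_lvar /= eqxx; case: (p); rewrite /= mulr1 subrr.
- rewrite dotBl dot_hvar dot_lvar /= eqxx.
  by case: (p); rewrite /= mul1r expr1 opprK (Num.Theory.pnatr_eq0 K 2).
- by rewrite dot_lvar /= eqxx mulr1 oner_neq0.
- by move=> i /orP[] /eqP -> ; apply: adm; rewrite /= eqxx.
move=> q c /killed_cons[q1 /killed_cons[q2 /killed_cons[q3 /killed_cons[q4 _]]]] hq.
apply: (eq0_all_mderiv hq) => a; rewrite -dderiv_axis.
have q5 : dderiv (axis (hvar (~~ p))) q = 0.
  rewrite -[LHS]subr0 -[in LHS]q1 -q2 /dderiv -sumrB; apply: eq_bigr => i _.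
  by rewrite !mxE scalerBl.
case: (hvar_or_lvar a) => [[b ->]|[b ->]].
  by have [->|] := eqVneq b p; rewrite // -addbT; case: b p q4 q5 {adm ki q1 q2 q3} => [] [].
by have [->|] := eqVneq b l; rewrite //; case: b l q1 q3 {adm ki q2 q4 q5} => [] [].
Qed.

Lemma fills_eight_plane p :
  fills eight_form flip [:: axis (hvar p)] [pred i | i.1.1 == p].
Proof.
pose line l := [pred i : bool * bool * bool | i.1 == (p, l)].
have ki l i : line l i -> killed [:: axis (hvar p)] (lf i).
  move=> /= /eqP il; apply: killed_linear_form => v; rewrite !inE => /eqP ->.
  by rewrite dot_hvar il /= eqxx.
move=> d e adm; apply: (@filled_sub _ _ _ _ _ (predU (line false) (line true))).
  by move=> i /orP[] /= /eqP ->.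
have ladm l i : line l i -> (e i + e (flip i) <= d.+1)%N.
  by move=> /eqP il; apply: adm; rewrite /= il.
apply: (@filled_join _ _ _ _ flip _ d (axis (lvar true)) (axis (lvar false)) _ _
  (p, false, false) (p, true, false)) => //=; rewrite ?eqxx //.
- exact: ki.
- exact: ki.
- by move=> i /eqP il; rewrite dot_lvar il mul0r.
- by move=> i /eqP il; rewrite dot_lvar il mul1r signr_eq0.
- by move=> i /eqP il; rewrite dot_lvar il mul0r.
- by move=> i /eqP il; rewrite dot_lvar il mul1r signr_eq0.
- exact: fills_eight_line.
- exact: fills_eight_line.
- exact: ladm.
- by move=> i il; apply/leqW/(ladm true).
Qed.

Lemma filled_eight d (e : bool * bool * bool -> nat) :
    (forall i, (e i + e (flip i) <= d.+1)%N) ->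
  filled eight_form [::] predT e d.
Proof.
move=> adm; pose plane p := [pred i : bool * bool * bool | i.1.1 == p].
apply: (@filled_sub _ _ _ _ _ (predU (plane false) (plane true))) => //.
apply: (@filled_join _ _ _ _ flip _ d (axis (hvar false)) (axis (hvar true)) _ _
  (false, false, false) (true, false, false)) => //=.
- by move=> i /eqP il; rewrite dot_hvar il.
- by move=> i /eqP il; rewrite dot_hvar il oner_neq0.
- by move=> i /eqP il; rewrite dot_hvar il.
- by move=> i /eqP il; rewrite dot_hvar il oner_neq0.
- exact: fills_eight_plane.
- exact: fills_eight_plane.
- by move=> i _; apply/leqW.
Qed.

End EightForms.

(** * Sums of four products, and pfaffians *)

Lemma sum_pair_bool (V : nmodType) (J : finType) (F : J * bool -> V) :
  \sum_i F i = \sum_j (F (j, false) + F (j, true)).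
Proof.
rewrite (eq_bigr (fun i => F (i.1, i.2))) => [|[] //].
rewrite -(pair_bigA _ (fun j c => F (j, c))) /=.
by apply: eq_bigr => j _; rewrite big_bool addrC.
Qed.

Section SumsOfFourProducts.

Variables (K : numClosedFieldType) (d : nat) (e : bool * bool * bool -> nat).

Local Notation coefficients := {ffun bool * bool * bool * 'X_{1..4 < d.+1} -> K^o}.

(** All factors are read off from one vector of coefficients, in which those of
    the monomials of degree other than e i are ignored: this keeps the space of
    parameters free of types that depend on i. *)
Definition factor (u : coefficients) (i : bool * bool * bool) : {mpoly K[4]} :=
  \sum_(m : 'X_{1..4 < d.+1} | mdeg m == e i) u (i, m) *: 'X_[m].

Lemma factor_linear c u v i : factor (c *: u + v) i = c *: factor u i + factor v i.
Proof.
rewrite /factor scaler_sumr -big_split /=; apply: eq_bigr => m _.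
by rewrite !ffunE scalerDl scalerA.
Qed.

Lemma factor_homog u i : factor u i \is (e i).-homog.
Proof. by apply: rpred_sum => m me; rewrite rpredZ // dhomogX. Qed.

Lemma factor_surj (f : bool * bool * bool -> {mpoly K[4]}) :
    (forall i, e i <= d)%N -> (forall i, f i \is (e i).-homog) ->
  exists u, factor u =1 f.
Proof.
move=> ed hf; exists [ffun im : bool * bool * bool * 'X_{1..4 < d.+1} => (f im.1)@_(im.2)] => i.
apply/mpolyP => k; rewrite raddf_sum /=.
under eq_bigr do rewrite ffunE mcoeffZ mcoeffX /=.
have [ke|kN] := eqVneq (mdeg k) (e i); last first.
  rewrite (dhomog_nemf_coeff (hf i)) // big1 // => m /eqP me.
  by case: eqP => [mk|_]; rewrite ?mulr0 // -mk me eqxx in kN *.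
have kd : (mdeg k < d.+1)%N by rewrite ke ltnS.
rewrite (bigD1 (BMultinom kd)) /= ?ke // eqxx mulr1 big1 ?addr0 // => m /andP[_ mk].
by rewrite -[_ == k]/(m == BMultinom kd) (negPf mk) mulr0.
Qed.

(** At the point whose factors are the powers of the eight forms, the image of
    the differential of the sum of products is the degree d part of the ideal
    that these powers generate. *)
Lemma general_sum_of_four_products :
    (forall i, e i + e (flip i) = d)%N ->
  for_general (fun F : dhomog 4 K d =>
    exists2 f : bool * bool * bool -> {mpoly K[4]},
      forall i, f i \is (e i).-homog &
      mpoly_of_dhomog F = \sum_j f (j, false) * f (j, true)).
Proof.
move=> ed; pose lf i : {mpoly K[4]} := linear_form (eight_form K i).
have e_le i : (e i <= d)%N by rewrite -(ed i) leq_addr.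
pose b (u v : coefficients) : {mpoly K[4]} :=
  \sum_(j : bool * bool) factor u (j, false) * factor v (j, true).
have hb u v : b u v \is d.-homog.
  by apply: rpred_sum => j _; rewrite -(ed (j, false)) dhomogM ?factor_homog.
pose B (u v : coefficients) : dhomog 4 K d := DHomog (hb u v).
have [u0 u0E] : exists u0 : coefficients, factor u0 =1 (fun i => lf i ^+ e i).
  apply: factor_surj => // i.
  by have := dhomogMn (e i) (linear_form_homog (eight_form K i)); rewrite mul1n.
have Br u : linear (B u).
  move=> c v v'; apply/val_inj; change (b u (c *: v + v') = c *: b u v + b u v').
  rewrite /b scaler_sumr -big_split.
  by apply: eq_bigr => j _; rewrite factor_linear mulrDr scalerAr.
have Bl v : linear (B^~ v).
  move=> c u u'; apply/val_inj; change (b (c *: u + u') v = c *: b u v + b u' v).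
  rewrite /b scaler_sumr -big_split.
  by apply: eq_bigr => j _; rewrite factor_linear mulrDl scalerAl.
have Bsurj w : exists u, B u0 u + B u u0 = w.
  have adm i : (e i + e (flip i) <= d.+1)%N by rewrite ed.
  have kw : killed [::] (mpoly_of_dhomog w) by [].
  (* The cofactor of the power of one form of a pair has the degree of the other
     form, and is the direction in which that other factor moves. *)
  have [s hs ws] := in_ideal_sum (filled_eight adm kw (dhomog_is_dhomog w)).
  have [u uE] : exists u : coefficients, factor u =1 (fun i => s (flip i)).
    by apply: factor_surj => // i; rewrite -(addnK (e (flip i)) (e i)) ed.
  exists u; apply/val_inj; change (b u0 u + b u u0 = mpoly_of_dhomog w).
  rewrite ws sum_pair_bool /b -big_split; apply: eq_bigr => j _; rewrite !u0E !uE.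
  by rewrite [s _ * _]mulrC.
have [Z [Zopen Zne ZP]] := for_general_quadratic Br Bl Bsurj.
exists Z; split=> // F /ZP[u ->]; exists (factor u) => //.
exact: factor_homog.
Qed.

End SumsOfFourProducts.

Section SkewMatrices.

Variables (K : comNzRingType) (x01 x23 x03 x12 : {mpoly K[4]}).

(** Two of the three products in a pfaffian suffice, so the entries at (0, 2)
    and (1, 3) are zero. *)
Definition skew_upper (i j : nat) : {mpoly K[4]} :=
  match i, j with
  | 0%N, 1%N => x01 | 2%N, 3%N => x23 | 0%N, 3%N => x03 | 1%N, 2%N => x12
  | _, _ => 0
  end.

Definition skew_mx : 'M[{mpoly K[4]}]_4 :=
  \matrix_(i, j) (skew_upper i j - skew_upper j i).

Lemma skew_mx_skew : skew_symmetric skew_mx.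
Proof. by apply/matrixP => i j; rewrite !mxE opprB. Qed.

Lemma pfaffian4_skew_mx : pfaffian4 skew_mx = x01 * x23 + x03 * x12.
Proof. by rewrite /pfaffian4 !mxE /= !subr0 mul0r subr0. Qed.

Lemma skew_mx_degree (A : 'M[nat]_4) : A^T = A ->
    x01 \is (A 0 1).-homog -> x23 \is (A 2 3).-homog ->
    x03 \is (A 0 3).-homog -> x12 \is (A 1 2).-homog ->
  has_degree_mx skew_mx A.
Proof.
move=> symA h01 h23 h03 h12.
have cast (k l i j : 'I_4) (x : {mpoly K[4]}) : i = k :> nat -> j = l :> nat ->
    x \is (A k l).-homog -> x \is (A i j).-homog.
  by move=> /val_inj -> /val_inj ->.
have up (i j : 'I_4) : skew_upper i j \is (A i j).-homog.
  case: i j => [[|[|[|[|//]]]] hi] [[|[|[|[|//]]]] hj]; rewrite /= ?rpred0 //.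
  - exact: (cast 0 1).
  - exact: (cast 0 3).
  - exact: (cast 1 2).
  - exact: (cast 2 3).
by move=> i j; rewrite mxE rpredB ?up // -symA mxE up.
Qed.

End SkewMatrices.

Lemma sum_products_pfaffian4 (K : comNzRingType)
    (f : bool * bool * bool -> {mpoly K[4]}) :
  let M p := skew_mx (f (p, false, false)) (f (p, false, true))
    (f (p, true, false)) (f (p, true, true)) in
  \sum_j f (j, false) * f (j, true) = pfaffian4 (M false) + pfaffian4 (M true).
Proof. by move=> M; rewrite sum_pair_bool big_bool /M !pfaffian4_skew_mx [LHS]addrC. Qed.

(** The identity A i j + A j i = A i i + A j j, summed over the two pairs of a
    partition of the indices. *)
Lemma half_trace (A : 'M[nat]_4) : A^T = A -> homogeneous_mx A ->
  addn (A 0 1) (A 2 3) = (\tr A)./2 /\ addn (A 0 3) (A 1 2) = (\tr A)./2.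
Proof.
move=> symA homA; have sA i j : A i j = A j i by rewrite -{1}symA mxE.
have diag i j : addn (A i i) (A j j) = (A i j).*2.
  by rewrite -addnn {2}[A i j]sA; apply: homA.
have trA : \tr A = addn (addn (A 0 0) (A 1 1)) (addn (A 2 2) (A 3 3)).
  rewrite /mxtrace !big_ord_recl big_ord0 /= addr0 -addnA.
  by congr (addn (A _ _) (addn (A _ _) (addn (A _ _) (A _ _)))); apply/val_inj.
split; rewrite trA; first by rewrite !diag -doubleD doubleK.
by rewrite [addn (A 2 2) _]addnC addnACA !diag -doubleD doubleK.
Qed.

Theorem theorem3p1 (R : realType) (A : 'M[nat]_4)
    (A_sym : A^T = A) (A_hom : homogeneous_mx A) :
  for_general (fun F : dhomog 4 R[i] (\tr A)./2 =>
    exists M N : 'M[{mpoly R[i][4]}]_4,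
      [/\ skew_symmetric M, has_degree_mx M A,
          skew_symmetric N, has_degree_mx N A
        & mpoly_of_dhomog F = pfaffian4 M + pfaffian4 N]).
Proof.
have [d01 d03] := half_trace A_sym A_hom.
pose e (i : bool * bool * bool) : nat :=
  if i.1.2 then if i.2 then A 1 2 else A 0 3 else if i.2 then A 2 3 else A 0 1.
have ed i : (e i + e (flip i) = (\tr A)./2)%N.
  by case: i => [[p []] []]; rewrite /e /= 1?addnC ?d01 ?d03 // addnC.
have [U [Uopen Une UP]] := @general_sum_of_four_products R[i] _ e ed.
exists U; split=> // F /UP[f hf ->].
pose M p := skew_mx (f (p, false, false)) (f (p, false, true))
  (f (p, true, false)) (f (p, true, true)).
have degM p : has_degree_mx (M p) A by apply: skew_mx_degree => //; apply: hf.
exists (M false), (M true); split=> //; do ?exact: skew_mx_skew.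
exact: sum_products_pfaffian4.
Qed.
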